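(* Let $R$ be a quasi-fiber product ring with respect to the regular sequence $\underline x=x_1,\ldots,x_n$. Let $M$ be a finitely generated $R$-module. If $t\ge\max\{5,n+1\}$ is an integer and $\operatorname{Ext}^i_R(M,M\oplus R)=0$ for every $i$ with $1\le i\le t+\operatorname{depth} R+n$, then $M$ is free. Thus: (a) if $n>4$ and $\operatorname{Ext}^i_R(M,M\oplus R)=0$ for $1\le i\le 3n+2$, then $M$ is free; (b) if $n\le 4$ and $\operatorname{Ext}^i_R(M,M\oplus R)=0$ for $1\le i\le 5+2n+1$, then $M$ is free; (c) if $n\le 4$ and $\operatorname{Ext}^i_R(M,M\oplus R)=0$ for $1\le i\le 14$, then $M$ is free.
   Context: All local rings are commutative and Noetherian. A local ring $(R,\mathfrak m,k)$ is a fiber product ring if $R\cong S\times_k T=\{(s,t)\in S\times T : \pi_S(s)=\pi_T(t)\}$, where $S,T$ are local rings with the same residue field $k$, neither of them equal to $k$, and $\pi_S,\pi_T$ are the reductions modulo the maximal ideals. Equivalently, $\mathfrak m=I\oplus J$ for nonzero ideals $I,J$ of $R$. A local ring $R$ is a quasi-fiber product ring with respect to $\underline x=x_1,\dots,x_n$ ($n\ge 0$) if $\underline x$ is an $R$-regular sequence such that $R/(\underline x)$ is a fiber product ring. *)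

(* Defs.v *)
From HB Require Import structures.
From mathcomp Require Import all_boot all_order all_algebra.
From mathcomp Require Import ring_quotient.
From mathcomp Require Import boolp classical_sets.

Set Implicit Arguments.
Unset Strict Implicit.
Unset Printing Implicit Defensive.

Import GRing.Theory.
Local Open Scope classical_set_scope.
Local Open Scope ring_scope.

Section Ideals.
Variable R : comNzRingType.

Definition is_ideal (I : set R) : Prop :=
  [/\ I 0, forall a b, I a -> I b -> I (a + b) & forall r a, I a -> I (r * a)].

Definition ideal_span (s : seq R) : set R :=
  [set r | exists c : 'I_(size s) -> R, r = \sum_i c i * s`_i].

Definition maximal_ideal (m : set R) : Prop :=
  [/\ is_ideal m, m != setT &
      forall I, is_ideal I -> I != setT -> m `<=` I -> I = m].

Definition noetherian : Prop :=
  forall I, is_ideal I -> exists s : seq R, I = ideal_span s.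

Definition noetherian_local : Prop :=
  noetherian /\ exists! m, maximal_ideal m.

(* Clause 1: s`_i is a nonzerodivisor on R/(s_0, ..., s_(i-1));
   clause 2: R/(s) is nonzero. *)
Definition regular_seq (s : seq R) : Prop :=
  (forall i, (i < size s)%N -> forall r,
     ideal_span (take i s) (s`_i * r) -> ideal_span (take i s) r)
  /\ ideal_span s != setT.

Definition regular_seq_in_maximal (s : seq R) : Prop :=
  regular_seq s /\ exists2 m, maximal_ideal m & forall a, a \in s -> m a.

Definition is_depth (d : nat) : Prop :=
  (exists2 s, regular_seq_in_maximal s & size s = d) /\
  (forall s, regular_seq_in_maximal s -> (size s <= d)%N).

End Ideals.

(* Only meaningful for a Noetherian local ring, where the supremum of the
   lengths of regular sequences in the maximal ideal is finite and attained;
   the default value 0 is then never used. *)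
Definition depth (R : comNzRingType) : nat := xget 0%N [set d | @is_depth R d].

Section FiberProduct.
Variables (S T : comNzRingType) (k : fieldType).
Variables (piS : {rmorphism S -> k}) (piT : {rmorphism T -> k}).

Definition fiber_pred : {pred S * T} := fun p => piS p.1 == piT p.2.

Lemma fiber_pred_subring : subring_closed fiber_pred.
Proof.
split=> [|p q|p q]; rewrite !unfold_in; first by rewrite !rmorph1.
- by move=> /eqP ep /eqP eq; rewrite !rmorphB ep eq.
- by move=> /eqP ep /eqP eq; rewrite !rmorphM ep eq.
Qed.

HB.instance Definition _ :=
  GRing.isSubringClosed.Build (S * T)%type fiber_pred fiber_pred_subring.

Record fiber_prod := FiberProd { fp_val : S * T; _ : fp_val \in fiber_pred }.

HB.instance Definition _ := [isSub for fp_val].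
HB.instance Definition _ := [Choice of fiber_prod by <:].
HB.instance Definition _ := [SubChoice_isSubComNzRing of fiber_prod by <:].

End FiberProduct.

(* A surjective morphism from a local ring onto a field k is the reduction
   modulo the maximal ideal, k being the residue field; the local ring equals
   its residue field exactly when this reduction is injective. *)
Definition fiber_product_ring (A : comNzRingType) : Prop :=
  noetherian_local A /\
  exists (S T : comNzRingType) (k : fieldType)
         (piS : {rmorphism S -> k}) (piT : {rmorphism T -> k}),
    [/\ noetherian_local S /\ noetherian_local T,
        (forall a, exists s, piS s = a) /\ (forall a, exists t, piT t = a),
        ~ injective piS /\ ~ injective piT
      & exists f : {rmorphism A -> fiber_prod piS piT}, bijective f].

(* The ideal (x) is given as an [idealr R], so that R/(x) is the library's
   quotient ring; it is determined by x as a set. *)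
Definition quasi_fiber_product_ring (R : comNzRingType) (n : nat)
    (x : n.-tuple R) : Prop :=
  [/\ noetherian_local R, regular_seq x &
      exists I : idealr R, [set r | r \in I] = ideal_span x /\
                           fiber_product_ring {ideal_quot I}].

Section Modules.
Variable R : comNzRingType.
Implicit Types M N P : lmodType R.

Definition finitely_generated M : Prop :=
  exists (n : nat) (g : 'I_n -> M),
    forall m, exists c : 'I_n -> R, m = \sum_i c i *: g i.

(* Free of finite rank, which is what "free" means for a finitely generated
   module over a nonzero ring. *)
Definition free_module M : Prop :=
  exists (n : nat) (f : {linear 'rV[R]_n -> M}), bijective f.

Definition projective P : Prop :=
  forall (A B : lmodType R) (p : {linear A -> B}) (f : {linear P -> B}),
    (forall b, exists a, p a = b) ->
    exists g : {linear P -> A}, forall y, p (g y) = f y.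

(* ... -> P_2 -> P_1 -> P_0 -> M -> 0, with pr_diff i : P_(i+1) -> P_i *)
Record projective_resolution M := ProjectiveResolution {
  pr_mod :> nat -> lmodType R;
  pr_diff : forall i, {linear pr_mod i.+1 -> pr_mod i};
  pr_aug : {linear pr_mod 0%N -> M};
  pr_projective : forall i, projective (pr_mod i);
  pr_aug_surj : forall m, exists y, pr_aug y = m;
  pr_exact0 : forall y, pr_aug y = 0 <-> exists z, pr_diff 0 z = y;
  pr_exactS : forall i y,
    pr_diff i y = 0 <-> exists z, pr_diff i.+1 z = y
}.

Section Cohomology.
Variables (M N : lmodType R) (P : projective_resolution M).

Definition ext_cocycle i (f : {linear P i -> N}) : Prop :=
  forall y, f (pr_diff P i y) = 0.

Definition ext_coboundary i : {linear P i -> N} -> Prop :=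
  match i return {linear P i -> N} -> Prop with
  | 0%N => fun f => forall y, f y = 0
  | j.+1 => fun f =>
      exists g : {linear P j -> N}, forall y, f y = g (pr_diff P j y)
  end.

End Cohomology.

(* Ext^i_R(M, N) = H^i(Hom_R(P, N)) = 0 for a projective resolution P of M;
   the choice of P does not matter. *)
Definition Ext_vanishes (i : nat) M N : Prop :=
  exists P : projective_resolution M,
    forall f : {linear P i -> N}, ext_cocycle f -> ext_coboundary f.

End Modules.

(* Main.v *)
(** Let [F] be a minimal free resolution of [M] and let [A = R/(x)].  The
    hypotheses shift to [Ext(M, Omega^b M)] and descend along the regular
    sequence, each element costing one degree: the tail of [F] tensored with
    [A] is still a minimal free resolution, with
    [Ext^1_A(Omega^4 N, Omega^3 N) = 0] for the module [N] it resolves.  The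
    maximal ideal of [A] is a direct sum of nonzero ideals [I] and [J] with
    [IJ = 0], so every syzygy in [m A^r] splits into its [I]-part and its
    [J]-part.  If [Omega^2 N] is nonzero, one of [I], [J] (say [J]) is a
    summand of [Omega^3 N]; then [I] is a summand of [Omega^4 N] and [J] of
    [Omega^5 N].  Projecting [Omega^5 N] onto that copy of [J] and including
    it in [Omega^3 N] gives a map that does not extend to the free cover of
    [Omega^4 N].  So [Omega^2 N = 0], hence the minimal resolution [F] is
    finite, and [Ext(M, R) = 0] makes it have length zero.

    Every computation over [R/Z] is done with matrices over [R] whose entries
    are compared modulo the ideal [Z]; vectors are rows, so the differential
    [d i] maps the free module of rank [b i.+1] to that of rank [b i].

    [depth R >= n] also needs the lengths of regular sequences to be bounded;
    this holds because [Ext^1_A(k, A)] is nonzero, so that some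
    [Ext^i_R(k, R)] with [i <= n + 1] is nonzero. *)

Require Import Defs.
From HB Require Import structures.
From mathcomp Require Import all_boot all_order all_algebra.
From mathcomp Require Import ring_quotient ring zify.
From mathcomp Require Import boolp classical_sets.

Set Implicit Arguments.
Unset Strict Implicit.
Unset Printing Implicit Defensive.

Import GRing.Theory.
Local Open Scope ring_scope.

Ltac mxring := apply/matrixP => ? ?; rewrite !mxE; ring.

(** * Matrices modulo an ideal *)

Section IdealMatrices.
Variable R : comNzRingType.
Implicit Types (I J Z : set R).

Lemma ideal0 I : is_ideal I -> I 0. Proof. by case. Qed.
Lemma idealD I a b : is_ideal I -> I a -> I b -> I (a + b).
Proof. by case=> _ h _; apply: h. Qed.
Lemma idealMl I a b : is_ideal I -> I b -> I (a * b).
Proof. by case=> _ _; apply. Qed.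
Lemma idealMr I a b : is_ideal I -> I a -> I (a * b).
Proof. by move=> hI Ia; rewrite mulrC; apply: idealMl. Qed.
Lemma idealN I a : is_ideal I -> I a -> I (- a).
Proof. by move=> hI Ia; rewrite -mulN1r; apply: idealMl. Qed.
Lemma idealB I a b : is_ideal I -> I a -> I b -> I (a - b).
Proof. by move=> hI Ia Ib; apply: idealD => //; apply: idealN. Qed.
Lemma ideal_sum I (T : finType) (F : T -> R) :
  is_ideal I -> (forall i, I (F i)) -> I (\sum_i F i).
Proof.
by move=> hI hF; apply: big_ind => //; [apply: ideal0|move=> *; apply: idealD].
Qed.

Definition mxin I m n (A : 'M[R]_(m, n)) : Prop := forall i j, I (A i j).

Section Closure.
Variables (I : set R) (hI : is_ideal I).

Lemma mxin0 m n : mxin I (0 : 'M_(m, n)).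
Proof. by move=> i j; rewrite mxE; apply: ideal0. Qed.
Lemma mxinD m n (A B : 'M_(m, n)) : mxin I A -> mxin I B -> mxin I (A + B).
Proof. by move=> hA hB i j; rewrite mxE; apply: idealD. Qed.
Lemma mxinN m n (A : 'M_(m, n)) : mxin I A -> mxin I (- A).
Proof. by move=> hA i j; rewrite mxE; apply: idealN. Qed.
Lemma mxinB m n (A B : 'M_(m, n)) : mxin I A -> mxin I B -> mxin I (A - B).
Proof. by move=> hA hB; apply: mxinD => //; apply: mxinN. Qed.
Lemma mxinMl m n p (A : 'M_(m, n)) (B : 'M_(n, p)) :
  mxin I B -> mxin I (A *m B).
Proof.
by move=> hB i j; rewrite mxE; apply: ideal_sum => // k; apply: idealMl.
Qed.
Lemma mxinMr m n p (A : 'M_(m, n)) (B : 'M_(n, p)) :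
  mxin I A -> mxin I (A *m B).
Proof.
by move=> hA i j; rewrite mxE; apply: ideal_sum => // k; apply: idealMr.
Qed.
Lemma mxinZ m n a (A : 'M_(m, n)) : mxin I A -> mxin I (a *: A).
Proof. by move=> hA i j; rewrite mxE; apply: idealMl. Qed.
Lemma mxinZr m n a (A : 'M_(m, n)) : I a -> mxin I (a *: A).
Proof. by move=> hA i j; rewrite mxE; apply: idealMr. Qed.

End Closure.

(** The ideal [Z + xR]; membership directly supplies the cofactor of [x] that the descent works
    with. *)
Definition adjoin_ideal Z x : set R := fun r => exists a, Z (r - x * a).

Lemma adjoin_ideal_is_ideal Z x : is_ideal Z -> is_ideal (adjoin_ideal Z x).
Proof.
move=> hZ; split; first by exists 0; rewrite mulr0 subr0; apply: ideal0.
  move=> r s [a ha] [c hc]; exists (a + c).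
  have -> : r + s - x * (a + c) = (r - x * a) + (s - x * c) by ring.
  exact: idealD.
move=> r s [a ha]; exists (r * a).
have -> : r * s - x * (r * a) = r * (s - x * a) by ring.
exact: idealMl.
Qed.

Lemma sub_adjoin_ideal Z x r : Z r -> adjoin_ideal Z x r.
Proof. by exists 0; rewrite mulr0 subr0. Qed.

Lemma mxin_adjoin Z x m n (A : 'M_(m, n)) :
  mxin (adjoin_ideal Z x) A -> exists B, mxin Z (A - x *: B).
Proof.
move=> hA.
have [f hf] : exists f : 'I_m * 'I_n -> R,
    forall p, Z (A p.1 p.2 - x * f p).
  by apply: (fin_all_exists (P := fun p r => Z (A p.1 p.2 - x * r))) => p;
     apply: hA.
by exists (\matrix_(i, j) f (i, j)) => i j; rewrite !mxE; apply: (hf (i, j)).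
Qed.

Lemma mxin_adjoinI Z x m n (A B : 'M_(m, n)) :
  mxin Z (A - x *: B) -> mxin (adjoin_ideal Z x) A.
Proof. by move=> h i j; exists (B i j); have := h i j; rewrite !mxE. Qed.

Lemma ideal_span_is_ideal (s : seq R) : is_ideal (ideal_span s).
Proof.
split; first by exists (fun=> 0); rewrite big1 // => i _; rewrite mul0r.
  move=> a c [f ->] [g ->]; exists (fun i => f i + g i).
  by rewrite -big_split; apply: eq_bigr => i _; rewrite mulrDl.
move=> r a [f ->]; exists (fun i => r * f i).
by rewrite mulr_sumr; apply: eq_bigr => i _; rewrite mulrA.
Qed.

Lemma mem_ideal_span (s : seq R) a : a \in s -> ideal_span s a.
Proof.
move=> /seq_tnthP[i ->]; exists (fun j => (j == i)%:R).
rewrite (bigD1 i) //= eqxx mul1r (tnth_nth 0) big1 ?addr0 //.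
by move=> j /negPf ->; rewrite mul0r.
Qed.

Lemma ideal_span_min (s : seq R) I a : is_ideal I ->
  (forall y, y \in s -> I y) -> ideal_span s a -> I a.
Proof.
move=> hI hs [c ->]; apply: ideal_sum => // i; apply: idealMl => //.
by apply: hs; apply: mem_nth.
Qed.

Lemma ideal_span_take (s : seq R) k : (k < size s)%N ->
  ideal_span (take k.+1 s) = adjoin_ideal (ideal_span (take k s)) s`_k.
Proof.
move=> ks; rewrite (take_nth 0) //.
have h1 := ideal_span_is_ideal (rcons (take k s) s`_k).
have h2 := adjoin_ideal_is_ideal s`_k (ideal_span_is_ideal (take k s)).
apply/seteqP; split=> a.
  apply: ideal_span_min => // y; rewrite mem_rcons inE => /orP[/eqP ->|ys].
    by exists 1; rewrite mulr1 subrr; apply: ideal0 (ideal_span_is_ideal _).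
  by apply: sub_adjoin_ideal; apply: mem_ideal_span.
case=> c hc; rewrite -[a](subrK (s`_k * c)); apply: idealD => //; last first.
  by apply: idealMr => //; apply: mem_ideal_span; rewrite mem_rcons inE eqxx.
apply: ideal_span_min hc => // y ys; apply: mem_ideal_span.
by rewrite mem_rcons inE ys orbT.
Qed.

End IdealMatrices.

(** * Reduction modulo a regular sequence *)

Section Complexes.
Variable R : comNzRingType.
Variables (b : nat -> nat) (d : forall i, 'M[R]_(b i.+1, b i)).
Implicit Types (I J Z : set R).

Definition exact_mod Z i := forall c (u : 'M_(c, b i.+1)),
  mxin Z (u *m d i) -> exists w, mxin Z (u - w *m d i.+1).

(* If [d] modulo [Z] is a resolution of [N] over [R/Z], the next two predicates
   say that [Ext^(i+1)(N, R/Z)] and [Ext^(i+1)(N, Omega^a N)] vanish, where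
   [Omega^a N] is presented as the cokernel of [d a]. *)
Definition Ext_ring_mod Z i := forall c (v : 'M_(b i.+1, c)),
  mxin Z (d i.+1 *m v) -> exists u, mxin Z (v - d i *m u).

Definition Ext_syz_mod Z i a := forall (V : 'M_(b i.+1, b a)) C,
  mxin Z (d i.+1 *m V - C *m d a) ->
  exists U U', mxin Z (V - d i *m U - U' *m d a).

Hypothesis dd : forall i, d i.+1 *m d i = 0.

Section Step.
Variables (Z : set R) (hZ : is_ideal Z) (x : R).
Hypothesis regx : forall r, Z (x * r) -> Z r.

Lemma mxin_cancel m n (A : 'M_(m, n)) : mxin Z (x *: A) -> mxin Z A.
Proof. by move=> h i j; apply: regx; have := h i j; rewrite mxE. Qed.

(** A cycle [u] modulo [Z + xR] has image [x v] modulo [Z]. As [x] is regular modulo [Z], [v] is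
    itself a cycle, hence the image of some [w], and [u - x w] is a cycle modulo [Z]. *)
Lemma exact_mod_adjoin i :
  exact_mod Z i -> exact_mod Z i.+1 -> exact_mod (adjoin_ideal Z x) i.+1.
Proof.
move=> ex0 ex1 c u /mxin_adjoin[v hv].
have /mxin_cancel /ex0[w hw] : mxin Z (x *: (v *m d i)).
  have -> : x *: (v *m d i) = - ((u *m d i.+1 - x *: v) *m d i).
    by rewrite mulmxBl -mulmxA dd mulmx0 sub0r opprK scalemxAl.
  by apply: mxinN => //; apply: mxinMr.
have /ex1[w' hw'] : mxin Z ((u - x *: w) *m d i.+1).
  have -> : (u - x *: w) *m d i.+1
            = (u *m d i.+1 - x *: v) + x *: (v - w *m d i.+1).
    by rewrite mulmxBl -scalemxAl; mxring.
  by apply: mxinD => //; apply: mxinZ.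
exists w'; apply: (mxin_adjoinI (B := w)).
by have -> : u - w' *m d i.+2 - x *: w = u - x *: w - w' *m d i.+2 by mxring.
Qed.

(** The argument of [exact_mod_adjoin] for cochains, with the matrices acting from the other
    side. *)
Lemma Ext_ring_mod_adjoin i : Ext_ring_mod Z i -> Ext_ring_mod Z i.+1 ->
  Ext_ring_mod (adjoin_ideal Z x) i.
Proof.
move=> E0 E1 c v /mxin_adjoin[w hw].
have /mxin_cancel /E1[u hu] : mxin Z (x *: (d i.+2 *m w)).
  have -> : x *: (d i.+2 *m w) = - (d i.+2 *m (d i.+1 *m v - x *: w)).
    by rewrite mulmxBr mulmxA dd mul0mx sub0r opprK scalemxAr.
  by apply: mxinN => //; apply: mxinMl.
have /E0[u' hu'] : mxin Z (d i.+1 *m (v - x *: u)).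
  have -> : d i.+1 *m (v - x *: u)
            = (d i.+1 *m v - x *: w) + x *: (w - d i.+1 *m u).
    by rewrite mulmxBr -scalemxAr; mxring.
  by apply: mxinD => //; apply: mxinZ.
exists u'; apply: (mxin_adjoinI (B := u)).
by have -> : v - d i *m u' - x *: u = v - x *: u - d i *m u' by mxring.
Qed.

(** The same correction by a multiple of [x], for maps taken modulo the image of [d a.+1]. Exactness
    at [a] embeds the cokernel of [d a.+1] into a free module, so [x] is regular on it; hence the
    successor index. *)
Lemma Ext_syz_mod_adjoin i a : exact_mod Z a ->
  Ext_syz_mod Z i a.+1 -> Ext_syz_mod Z i.+1 a.+1 ->
  Ext_syz_mod (adjoin_ideal Z x) i a.+1.
Proof.
move=> ex E0 E1 V C /mxin_adjoin[W hW].
set D := d i.+1 *m V - _ - _ in hW.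
have hDa : mxin Z (x *: (d i.+2 *m W *m d a)).
  have -> : x *: (d i.+2 *m W *m d a) = - (d i.+2 *m D *m d a).
    rewrite /D !mulmxBr !mulmxBl !mulmxA dd !mul0mx sub0r.
    rewrite -[_ *m d a.+1 *m d a]mulmxA dd mulmx0 oppr0 sub0r opprK.
    by rewrite -scalemxAr -!scalemxAl.
  by apply: mxinN => //; apply: mxinMr => //; apply: mxinMl.
have [C' hC'] := ex _ _ (mxin_cancel hDa).
have [U [U' hU]] := E1 _ _ hC'.
have [|U1 [U1' hU1]] := E0 (V - x *: U) (C + x *: U').
  have -> : d i.+1 *m (V - x *: U) - (C + x *: U') *m d a.+1
     = D + x *: (W - d i.+1 *m U - U' *m d a.+1).
    by rewrite /D mulmxBr mulmxDl -!scalemxAr -!scalemxAl; mxring.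
  by apply: mxinD => //; apply: mxinZ.
exists U1, U1'; apply: (mxin_adjoinI (B := U)).
have -> : V - d i *m U1 - U1' *m d a.+1 - x *: U
  = V - x *: U - d i *m U1 - U1' *m d a.+1 by mxring.
exact: hU1.
Qed.

End Step.

(** Dimension shift along [0 -> Omega^(a+1) -> F_a -> Omega^a -> 0], with [Ext^(i+2)] into the free
    module [F_a] vanishing. *)
Lemma Ext_syz_mod_shift i a Z : is_ideal Z -> exact_mod Z a ->
  Ext_ring_mod Z i.+1 -> Ext_syz_mod Z i a -> Ext_syz_mod Z i.+1 a.+1.
Proof.
move=> hZ ex G E V C hV.
have /G[u hu] : mxin Z (d i.+2 *m (V *m d a)).
  have -> : d i.+2 *m (V *m d a) = (d i.+2 *m V - C *m d a.+1) *m d a.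
    by rewrite mulmxBl -[C *m _ *m _]mulmxA dd mulmx0 subr0 mulmxA.
  exact: mxinMr.
have [|U [U' hU]] := E u V.
  by rewrite -opprB; apply: mxinN.
have /ex[w hw] : mxin Z ((V - d i.+1 *m U') *m d a).
  have -> : (V - d i.+1 *m U') *m d a
    = (V *m d a - d i.+1 *m u) + d i.+1 *m (u - d i *m U - U' *m d a).
    by rewrite mulmxBl !mulmxBr !mulmxA dd mul0mx; mxring.
  by apply: mxinD => //; apply: mxinMl.
by exists U', w.
Qed.

Section Sequence.
Variables s : seq R.
Hypothesis regs : forall i, (i < size s)%N -> forall r,
  ideal_span (take i s) (s`_i * r) -> ideal_span (take i s) r.
Let Z k := ideal_span (take k s).

Hypothesis ex0 : forall i, exact_mod (ideal_span [::]) i.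

Lemma exact_mod_take k i : (k <= size s)%N -> (k <= i)%N -> exact_mod (Z k) i.
Proof.
elim: k i => [|k IH] i; first by rewrite /Z take0.
case: i => [|i] // ks ki; rewrite /Z ideal_span_take //.
apply: (exact_mod_adjoin (ideal_span_is_ideal _) (regs ks) _ _).
- by apply: IH => //; apply: ltnW.
- by apply: IH; apply: ltnW.
Qed.

Lemma Ext_ring_mod_take k i : (k <= size s)%N ->
  (forall j, (i <= j <= i + k)%N -> Ext_ring_mod (ideal_span [::]) j) ->
  Ext_ring_mod (Z k) i.
Proof.
elim: k i => [|k IH] i ks E; first by rewrite /Z take0; apply: E; lia.
rewrite /Z ideal_span_take //.
apply: (Ext_ring_mod_adjoin (ideal_span_is_ideal _) (regs ks) _ _).
- by apply: IH => [|j hj]; [apply: ltnW|apply: E; lia].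
- by apply: IH => [|j hj]; [apply: ltnW|apply: E; lia].
Qed.

(** The bound [k <= a.+1] keeps degree [a] among those where exactness has survived all earlier
    reductions. *)
Lemma Ext_syz_mod_take k i a : (k <= size s)%N -> (k <= a.+1)%N ->
  (forall j, (i <= j <= i + k)%N -> Ext_syz_mod (ideal_span [::]) j a.+1) ->
  Ext_syz_mod (Z k) i a.+1.
Proof.
elim: k i => [|k IH] i ks ka E; first by rewrite /Z take0; apply: E; lia.
rewrite /Z ideal_span_take //.
apply: (Ext_syz_mod_adjoin (ideal_span_is_ideal _) (regs ks) _ _ _).
- by apply: exact_mod_take => //; apply: ltnW.
- by apply: IH => [||j hj]; [apply: ltnW|apply: ltnW|apply: E; lia].
- by apply: IH => [||j hj]; [apply: ltnW|apply: ltnW|apply: E; lia].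
Qed.

Lemma Ext_syz_mod_shifts e i a :
  (forall j, (i < j <= i + e)%N -> Ext_ring_mod (ideal_span [::]) j) ->
  Ext_syz_mod (ideal_span [::]) i a ->
  Ext_syz_mod (ideal_span [::]) (e + i) (e + a).
Proof.
elim: e => [|e IH] // G E; rewrite !addSn; apply: Ext_syz_mod_shift => //.
- exact: ideal_span_is_ideal.
- by apply: G; lia.
- by apply: IH => // j hj; apply: G; lia.
Qed.

End Sequence.
End Complexes.

(** * Local rings and fiber products *)

Section Local.
Variable R : comNzRingType.
Implicit Types (I J Z m : set R).

(** Elementwise form of [m] being the unique maximal ideal: everything outside it is a unit. *)
Definition local_at m : Prop :=
  [/\ is_ideal m, ~ m 1 & forall a, ~ m a -> exists c, c * a = 1].

Lemma local_at_prime m a c : local_at m -> ~ m a -> ~ m c -> ~ m (a * c).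
Proof.
move=> [hm m1 mu] /mu[a' ha] /mu[c' hc] mac; apply: m1.
have -> : 1 = (a' * c') * (a * c) by rewrite mulrACA ha hc mulr1.
exact: idealMl.
Qed.

Lemma local_at_cancel m Z a c :
  local_at m -> is_ideal Z -> ~ m a -> Z (c * a) -> Z c.
Proof.
move=> [_ _ mu] hZ /mu[a' ha] h.
have -> : c = a' * (c * a) by rewrite mulrCA ha mulr1.
exact: idealMl.
Qed.

Lemma ideal_span_cons y (s : seq R) a :
  ideal_span (y :: s) a -> exists c, ideal_span s (a - y * c).
Proof.
move=> [f ->]; exists (f ord0); exists (fun i => f (lift ord0 i)).
by rewrite big_ord_recl /= mulrC addrC addKr.
Qed.

(** If [J] lies in [Z + mJ], it lies in [Z]. Induction on generators of [J] modulo [Z]; the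
    induction hypothesis is applied with the first generator [y] adjoined to [Z]. *)
Lemma nakayama m J Z : noetherian R -> local_at m -> is_ideal J -> is_ideal Z ->
  (forall a, J a -> exists c (u v : 'I_c -> R),
     [/\ forall i, m (u i), forall i, J (v i) & Z (a - \sum_i u i * v i)]) ->
  forall a, J a -> Z a.
Proof.
move=> noe hm hJ hZ mJ; have [s Js] := noe _ hJ.
have sJ y : y \in s -> J y by rewrite Js; apply: mem_ideal_span.
have sp a : J a -> exists2 z, Z z & ideal_span s (a - z).
  by move=> Ja; exists 0; [apply: ideal0|rewrite subr0 -Js].
elim: s {Js} Z hZ mJ sJ sp => [|y s IH] Z hZ mJ sJ sp a Ja.
  have [z Zz [f]] := sp a Ja.
  by rewrite big_ord0 => /eqP; rewrite subr_eq0 => /eqP ->.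
have hZy := adjoin_ideal_is_ideal y hZ.
have JZy : forall a, J a -> adjoin_ideal Z y a.
  apply: IH => //.
  - move=> t /mJ[c [u [v [hu hv h]]]]; exists c, u, v; split=> //.
    exact: sub_adjoin_ideal.
  - by move=> t ts; apply: sJ; rewrite inE ts orbT.
  - move=> t /sp[z Zz /ideal_span_cons[c hc]]; exists (z + y * c).
      by exists c; rewrite addrK.
    by rewrite opprD addrA.
(* Each [v i] is [y * f i] modulo [Z], so [y] times the unit [1 - \sum_i u i * f i] lies in [Z]. *)
have Zy : Z y.
  have [c [u [v [hu hv h]]]] := mJ y (sJ y (mem_head _ _)).
  have [f hf] := fin_all_exists (fun i => JZy _ (hv i)).
  apply: (local_at_cancel (a := 1 - \sum_i u i * f i) hm) => //.
    case: hm => hm m1 _ h1; apply: m1; rewrite -[1](subrK (\sum_i u i * f i)).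
    by apply: idealD => //; apply: ideal_sum => // i; apply: idealMr.
  have -> : y * (1 - \sum_i u i * f i)
    = (y - \sum_i u i * v i) + \sum_i u i * (v i - y * f i).
    under [X in _ = _ + X]eq_bigr do rewrite mulrBr mulrCA.
    by rewrite sumrB mulrBr mulr1 mulr_sumr; ring.
  by apply: idealD => //; apply: ideal_sum => // i; apply: idealMl.
have [c hc] := JZy _ Ja; rewrite -[a](subrK (y * c)).
by apply: idealD => //; apply: idealMr.
Qed.

End Local.

(** * Copies of the ideals [I] and [J] inside syzygies *)

Section FiberProductCore.
Variable R : comNzRingType.
Variables (b : nat -> nat) (d : forall i, 'M[R]_(b i.+1, b i)).
Variables (m Z : set R).
Hypothesis noe : noetherian R.
Hypothesis hm : local_at m.
Hypothesis hZ : is_ideal Z.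
Hypothesis dd : forall i, d i.+1 *m d i = 0.
Hypothesis dm : forall i, mxin m (d i).
Let hmi : is_ideal m. Proof. by case: hm. Qed.

(* [m / Z] is the direct sum of [I / Z] and [J / Z]. *)
Definition splits_mod (I J : set R) : Prop :=
  [/\ is_ideal I /\ is_ideal J, forall a, Z a -> I a /\ J a,
      forall a, m a -> exists i j, [/\ I i, J j & a = i + j],
      forall a, I a \/ J a -> m a &
      forall a, I a -> J a -> Z a].

Lemma splits_modC I J : splits_mod I J -> splits_mod J I.
Proof.
move=> [[hI hJ] ZIJ sp IJm IJ]; split=> //.
- by move=> a /ZIJ[].
- by move=> a /sp[i [j [Ii Jj ->]]]; exists j, i; rewrite addrC.
- by move=> a h; apply: IJm; case: h; [right|left].
- by move=> a Ja Ia; apply: IJ.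
Qed.

(* The vector [g] has a unit coordinate and [J g] consists of syzygies modulo
   [Z], so that coordinate splits the embedding [j |-> j g] of [J / Z] into the
   kernel of the reduction of [d k]. *)
Definition syzygy_summand (J : set R) k : Prop :=
  exists g : 'rV_(b k.+1), (exists r, ~ m (g 0 r)) /\
    forall j, J j -> mxin Z (j *: (g *m d k)).

Section Split.
Variables (I J : set R).
Hypothesis IJ : splits_mod I J.

Lemma mxin_split k l (A : 'M_(k, l)) : mxin m A ->
  exists B C, [/\ mxin I B, mxin J C & A = B + C].
Proof.
case: IJ => _ _ sp _ _ hA.
have [f hf] : exists f : 'I_k * 'I_l -> R * R, forall p,
    [/\ I (f p).1, J (f p).2 & A p.1 p.2 = (f p).1 + (f p).2].
  apply: (fin_all_exists (P := fun p (q : R * R) =>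
    [/\ I q.1, J q.2 & A p.1 p.2 = q.1 + q.2])) => p.
  by have [i [j h]] := sp _ (hA p.1 p.2); exists (i, j).
exists (\matrix_(i, j) (f (i, j)).1), (\matrix_(i, j) (f (i, j)).2); split.
- by move=> i j; rewrite mxE; case: (hf (i, j)).
- by move=> i j; rewrite mxE; case: (hf (i, j)).
- by apply/matrixP => i j; rewrite !mxE; case: (hf (i, j)).
Qed.

(** Components are unique modulo [Z] because [I] and [J] meet inside [Z]. *)
Lemma split_cancel a c : I a -> J c -> Z (a + c) -> Z a /\ Z c.
Proof.
case: IJ => [[hI hJ] ZIJ _ _ IJZ] Ia Jc Zac.
have Za : Z a.
  apply: IJZ => //; rewrite -[a](addrK c); apply: idealB => //.
  by have [] := ZIJ _ Zac.
by split=> //; rewrite -[c](addKr a) addrC; apply: idealB.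
Qed.

Lemma mxin_split_cancel k l (A B : 'M_(k, l)) :
  mxin I A -> mxin J B -> mxin Z (A + B) -> mxin Z A /\ mxin Z B.
Proof.
move=> hA hB hAB; have h i j : Z (A i j) /\ Z (B i j).
  by apply: split_cancel (hA i j) (hB i j) _; have := hAB i j; rewrite mxE.
by split=> i j; have [] := h i j.
Qed.

Lemma split_mul a c : I a -> J c -> Z (a * c).
Proof.
case: IJ => [[hI hJ] _ _ _ IJZ] Ia Jc.
by apply: IJZ; [apply: idealMr|apply: idealMl].
Qed.

Lemma split_subm a : J a -> m a.
Proof. by case: IJ => _ _ _ h _ Ja; apply: h; right. Qed.

Lemma Z_subm a : Z a -> m a.
Proof. by case: IJ => _ h _ _ _ /h[_ /split_subm]. Qed.

(** By Nakayama [J] is not contained in [Z + mJ]; the element found is a minimal generator of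
    [J / Z]. *)
Lemma split_nz : (exists2 a, J a & ~ Z a) ->
  exists2 a, J a & forall c (u v : 'I_c -> R),
    (forall i, m (u i)) -> (forall i, J (v i)) -> ~ Z (a - \sum_i u i * v i).
Proof.
case=> a Ja nZa; apply: contrapT => H; apply: nZa.
case: (IJ) => [[hI hJ] _ _ _ _].
apply: (nakayama noe hm hJ hZ _ Ja) => t Jt; apply: contrapT => Ht.
by apply: H; exists t => // c u v hu hv hz; apply: Ht; exists c, u, v.
Qed.

(** For a minimal generator [j] of [J / Z], write [j g = w d_(k+1)] modulo [Z]. Since [I j] lies in
    [Z], [I w] consists of syzygies. If [w] had all entries in [m], comparing [J]-parts in
    coordinate [r] would put [j] in [Z + mJ]. *)
Lemma syzygy_summand_next k : exact_mod d Z k -> (exists2 a, J a & ~ Z a) ->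
  syzygy_summand J k -> syzygy_summand I k.+1.
Proof.
move=> ex /split_nz[j Jj nj] [g [[r gr] hg]].
have [|w hw] := ex _ (j *: g); first by rewrite -scalemxAl; apply: hg.
exists w; split; last first.
  move=> i Ii; rewrite -[w *m _](subrK (j *: g)) scalerDr.
  apply: mxinD => //; last first.
    by rewrite scalerA; apply: mxinZr => //; apply: split_mul.
  by apply: mxinZ => //; rewrite -opprB; apply: mxinN.
apply: contrapT => H.
have {H} wm s : m (w 0 s).
  by apply: contrapT => h; apply: H; exists s.
have [B [C [hB hC dBC]]] := mxin_split (@dm k.+1).
case: (IJ) => [[hI hJ] ZIJ _ _ _].
have [e eg] : exists e, e * g 0 r = 1 by case: hm => _ _; apply.
apply: (nj _ (fun s => e * w 0 s) (fun s => C s r)) => //.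
  by move=> s; apply: idealMl.
have -> : \sum_s e * w 0 s * C s r = e * (w *m C) 0 r.
  by rewrite mxE mulr_sumr; apply: eq_bigr => s _; rewrite mulrA.
have -> : j - e * (w *m C) 0 r = e * (j * g 0 r - (w *m C) 0 r).
  by rewrite mulrBr mulrCA eg mulr1.
apply: idealMl => //.
have [|||_ //] := split_cancel (a := - (w *m B) 0 r)
  (c := j * g 0 r - (w *m C) 0 r).
- by apply: idealN => //; apply: mxinMl.
- by apply: idealB => //; [apply: idealMr|apply: mxinMl].
have := hw 0 r; rewrite dBC mulmxDr !mxE.
by congr Z; ring.
Qed.

(** The image of a basis vector [D] splits as [B + C], and both parts are syzygies, lifted to [g]
    and [g']. By minimality [D - g - g'] has entries in [m], so [g] or [g'] has a unit coordinate.
    As [J] kills [B] and [I] kills [C], that lift gives a summand. *)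
Lemma syzygy_summand_start k : exact_mod d Z k -> exact_mod d Z k.+1 ->
  b k.+2 != 0%N -> syzygy_summand I k.+1 \/ syzygy_summand J k.+1.
Proof.
move=> ex ex1; rewrite -lt0n => bk; pose r := Ordinal bk.
case: (IJ) => [[hI hJ] _ _ _ _].
pose D : 'rV[R]_(b k.+2) := delta_mx 0 r.
have [B [C [hB hC dBC]]] := mxin_split (mxinMl hmi D (@dm k.+1)).
have [hBd hCd] : mxin Z (B *m d k) /\ mxin Z (C *m d k).
  apply: mxin_split_cancel; try exact: mxinMr.
  by rewrite -mulmxDl -dBC -mulmxA dd mulmx0; apply: mxin0.
have [g hg] := ex _ _ hBd; have [g' hg'] := ex _ _ hCd.
have /ex1[w hw] : mxin Z ((D - g - g') *m d k.+1).
  have -> : (D - g - g') *m d k.+1 = (B - g *m d k.+1) + (C - g' *m d k.+1).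
    by rewrite !mulmxBl dBC; mxring.
  exact: mxinD.
apply: contrapT => /not_orP[nI nJ]; case: hm => _ m1 _; apply: m1.
have [g'm gm] : m (g' 0 r) /\ m (g 0 r).
  split; apply: contrapT => h; [apply: nI; exists g'|apply: nJ; exists g].
    split=> [|i Ii]; first by exists r.
    have -> : i *: (g' *m d k.+1) = i *: C - i *: (C - g' *m d k.+1) by mxring.
    apply: mxinB => //; last by apply: mxinZ.
    by move=> s t; rewrite mxE; apply: split_mul.
  split=> [|i Ji]; first by exists r.
  have -> : i *: (g *m d k.+1) = i *: B - i *: (B - g *m d k.+1) by mxring.
  apply: mxinB => //; last by apply: mxinZ.
  by move=> s t; rewrite mxE mulrC; apply: split_mul.
have -> : 1 = (D - g - g' - w *m d k.+2) 0 r + g 0 r + g' 0 r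
              + (w *m d k.+2) 0 r.
  by rewrite !mxE !eqxx /=; ring.
apply: idealD => //; last by apply: mxinMl.
by apply: idealD => //; apply: idealD => //; apply: Z_subm; apply: hw.
Qed.

(** Extending the map from syzygies to [J] to [g J] over the free cover would express [j] times a
    vector with a unit coordinate as zero modulo [Z]. *)
Lemma syzygy_summand_Ext k : exact_mod d Z k -> exact_mod d Z k.+1 ->
  exact_mod d Z k.+2 -> Ext_syz_mod d Z k.+3 k.+2 ->
  syzygy_summand J k -> syzygy_summand J k.+2 -> forall j, J j -> Z j.
Proof.
move=> ex0 ex1 ex2 E [g [[r gr] hg]] [h [[s hs] hh]] j Jj.
case: (IJ) => [[hI hJ] ZIJ _ _ IJZ].
(* [C], the [J]-part of coordinate [s], is the projection onto the copy of [J] generated along [h],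
   up to the unit [h 0 s]. *)
have cm : mxin m (col s (d k.+3)) by move=> i l; rewrite mxE; apply: dm.
have [B [C [hB hC dBC]]] := mxin_split cm.
have [_ dC] : mxin Z (d k.+4 *m B) /\ mxin Z (d k.+4 *m C).
  apply: mxin_split_cancel; try exact: mxinMl.
  by rewrite -mulmxDr -dBC colE mulmxA dd mul0mx; apply: mxin0.
(* [W] lifts the composite of this projection with the inclusion along [g]; [hY] says that it is a
   cocycle modulo the image of [d k.+2]. *)
have /ex0[W hW] : mxin Z (C *m g *m d k).
  rewrite -mulmxA => p q; rewrite mxE big_ord1.
  by have := hg _ (hC p 0) 0 q; rewrite mxE.
have /ex1[Y hY] : mxin Z (d k.+4 *m W *m d k.+1).
  have -> : d k.+4 *m W *m d k.+1
    = d k.+4 *m C *m g - d k.+4 *m (C *m g - W *m d k.+1).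
    by rewrite mulmxBr !mulmxA; mxring.
  by apply: mxinB => //; [apply: mxinMr|apply: mxinMl].
have [U [U' hU]] := E _ _ hY.
have [w hw] : exists w, mxin Z (j *: h - w *m d k.+3).
  by apply: ex2; rewrite -scalemxAl; apply: hh.
(* Compare [J]-parts of coordinate [s] in [j h = w d_(k+3)]. *)
have hwC : Z ((w *m C) 0 0 - j * h 0 s).
  have [|||_ //] := split_cancel (a := (w *m B) 0 0)
    (c := (w *m C) 0 0 - j * h 0 s).
  - exact: mxinMl.
  - by apply: idealB => //; [apply: mxinMl|apply: idealMr].
  have -> : (w *m B) 0 0 + ((w *m C) 0 0 - j * h 0 s)
    = - (j *: h - w *m d k.+3) 0 s.
    have e : (w *m d k.+3) 0 s = (w *m B + w *m C) 0 0.
      by rewrite -mulmxDr -dBC colE mulmxA -colE [RHS]mxE.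
    by rewrite !mxE in e *; rewrite e; ring.
  by apply: idealN.
pose X := h *m U *m d k.+1.
(* Evaluating [C g = W d_(k+1)] at [w] and replacing [W] by its coboundary form turns [w d_(k+3)]
   into [j h]; the term in [U'] dies because [dd] holds. *)
have hX : mxin Z (j *: (h 0 s *: g - X)).
  have -> : j *: (h 0 s *: g - X) = - (((w *m C) 0 0 - j * h 0 s) *: g)
     + w *m (C *m g - W *m d k.+1)
     + w *m (W - d k.+3 *m U - U' *m d k.+2) *m d k.+1
     - (j *: h - w *m d k.+3) *m U *m d k.+1.
    have -> : w *m (C *m g - W *m d k.+1)
      = (w *m C) 0 0 *: g - w *m W *m d k.+1.
      rewrite mulmxBr !mulmxA; congr (_ - _).
      by rewrite {1}[w *m C]mx11_scalar mul_scalar_mx.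
    rewrite !mulmxBr !mulmxBl !mulmxA -[_ *m d k.+2 *m d k.+1]mulmxA dd mulmx0.
    by rewrite /X -!scalemxAl; mxring.
  apply: mxinB => //; last by apply: mxinMr => //; apply: mxinMr.
  apply: mxinD => //; last by apply: mxinMr => //; apply: mxinMl.
  by apply: mxinD => //; [apply: mxinN => //; apply: mxinZr|apply: mxinMl].
(* The entries of [X] lie in [m] and [h 0 s * g 0 r] is a unit, so the factor multiplying [j] is a
   unit. *)
apply: (local_at_cancel (a := h 0 s * g 0 r - X 0 r) hm) => //; last first.
  by have := hX 0 r; rewrite !mxE.
have := local_at_prime hm hs gr; apply: contra_not => hr.
rewrite -[_ * _](subrK (X 0 r)); apply: idealD => //.
by rewrite /X; apply: mxinMl.
Qed.

End Split.

(** Here [N] is the module resolved from degree [k] on. Each step to the next syzygy exchanges [I]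
    and [J], so two steps return to the ideal of the starting summand. *)
Lemma fiber_product_vanishing I J k :
  splits_mod I J -> (exists2 a, I a & ~ Z a) -> (exists2 a, J a & ~ Z a) ->
  (forall i, (k <= i)%N -> exact_mod d Z i) ->
  Ext_syz_mod d Z k.+4 k.+3 -> b k.+2 = 0%N.
Proof.
move=> IJ nI nJ ex E; apply/eqP; apply: contrapT => /negP bk.
have JI := splits_modC IJ.
have [h|h] := syzygy_summand_start IJ (ex _ (leqnn k)) (ex _ (leqnSn k)) bk.
  have h3 : syzygy_summand I k.+3.
    apply: (syzygy_summand_next IJ) => //; first by apply: ex; lia.
    by apply: (syzygy_summand_next JI) => //; apply: ex; lia.
  have [a Ia] := nI; apply; apply: (syzygy_summand_Ext JI) E h h3 _ Ia;
    by apply: ex; lia.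
have h3 : syzygy_summand J k.+3.
  apply: (syzygy_summand_next JI) => //; first by apply: ex; lia.
  by apply: (syzygy_summand_next IJ) => //; apply: ex; lia.
have [a Ja] := nJ; apply; apply: (syzygy_summand_Ext IJ) E h h3 _ Ja;
  by apply: ex; lia.
Qed.

End FiberProductCore.

(** * Minimal free resolutions *)

Section LocalRings.
Local Open Scope classical_set_scope.
Variable R : comNzRingType.

Lemma maximal_ideal_above (I : set R) : is_ideal I -> ~ I 1 ->
  exists2 m, maximal_ideal m & I `<=` m.
Proof.
move=> hI nI.
pose P (A : set R) := A = set0 \/ [/\ is_ideal A, ~ A 1 & I `<=` A].
have [F FP Ftot|A [PA Amax]] := @Zorn_bigcup _ P.
  have [[B FB B0]|noB] := pselect (exists2 B, F B & B 0); last first.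
    left; rewrite -subset0 => a [B FB Ba].
    case: (FP _ FB) => [B0|[hB _ _]]; first by rewrite B0 in Ba.
    by apply: noB; exists B => //; apply: ideal0.
  have FI C : F C -> C !=set0 -> [/\ is_ideal C, ~ C 1 & I `<=` C].
    by move=> FC [a Ca]; case: (FP _ FC) => // C0; rewrite C0 in Ca.
  right; split.
  - split; first by exists B.
      move=> a c [C FC Ca] [D FD Dc].
      have [hC _ _] := FI _ FC (ex_intro _ _ Ca).
      have [hD _ _] := FI _ FD (ex_intro _ _ Dc).
      have [CD|DC] := Ftot _ _ FC FD.
        by exists D => //; apply: idealD => //; apply: CD.
      by exists C => //; apply: idealD => //; apply: DC.
    move=> r a [C FC Ca]; exists C => //; apply: idealMl => //.
    by have [hC _ _] := FI _ FC (ex_intro _ _ Ca).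
  - by move=> [C FC C1]; have [_ + _] := FI _ FC (ex_intro _ _ C1).
  - move=> a Ia; exists B => //; have [_ _] := FI _ FB (ex_intro _ _ B0).
    exact.
case: PA => [A0|[hA A1 IA]].
  case: (Amax I); last by right; split.
  by rewrite A0; split=> [a //|/(_ 0)]; apply; apply: ideal0.
exists A => //; split=> //.
  by apply/eqP => AT; apply: A1; rewrite AT.
move=> J hJ JT AJ; apply/seteqP; split=> //.
apply: contrapT => nJA; apply: (Amax J); first by split.
right; split=> //; last exact: subset_trans AJ.
move=> J1; move/eqP: JT; apply; apply/seteqP; split=> // a _.
by rewrite -[a]mulr1; apply: idealMl.
Qed.

Lemma proper_ideal1 (I : set R) : is_ideal I -> I != setT -> ~ I 1.
Proof.
move=> hI /eqP IT I1; apply: IT; apply/seteqP; split=> // a _.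
by rewrite -[a]mulr1; apply: idealMl.
Qed.

Lemma noetherian_local_at (m : set R) :
  noetherian_local R -> maximal_ideal m -> local_at m.
Proof.
move=> [_ [m' [hm' um']]] hm; have em := um' _ hm; subst m'.
have [mi mT _] := hm; split=> //; first exact: proper_ideal1.
move=> a ma; have hs := ideal_span_is_ideal [:: a].
have [[f]|n1] := pselect (ideal_span [:: a] 1).
  by rewrite /= big_ord1 /= => ->; exists (f ord0).
have [m' /um' <- am] := maximal_ideal_above hs n1.
by case: ma; apply: am; apply: mem_ideal_span; rewrite mem_head.
Qed.

End LocalRings.

(** * Minimal generators and the construction of minimal resolutions *)

Section FreeResolutions.
Variable R : comNzRingType.

Definition submodule (V : lmodType R) (K : set V) : Prop :=
  [/\ K 0, forall u v, K u -> K v -> K (u + v) & forall a u, K u -> K (a *: u)].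

Definition generates (V : lmodType R) c (g : 'I_c -> V) (K : set V) : Prop :=
  forall v, K v <-> exists u : 'rV_c, v = \sum_i u 0 i *: g i.

(** A relation with a unit coefficient expresses one generator through the others, which is then
    dropped. *)
Lemma minimal_generators (m : set R) (V : lmodType R) c (g : 'I_c -> V) K :
  local_at m -> generates g K ->
  exists c' (g' : 'I_c' -> V), generates g' K /\
    forall u : 'rV_c', \sum_i u 0 i *: g' i = 0 -> mxin m u.
Proof.
move=> hm; elim: c g => [|c IH] g hg.
  by exists 0%N, g; split=> // u _ i [].
have [//|] := pselect (forall u : 'rV_c.+1,
  \sum_i u 0 i *: g i = 0 -> mxin m u).
  by exists c.+1, g.
move=> /existsNP[u /not_implyP[hu]] /existsNP[i /existsNP[r]].
rewrite ord1 => ur; have [e eu] : exists e, e * u 0 r = 1.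
  by case: hm => _ _; apply.
apply: (IH (fun j => g (lift r j))) => v; rewrite hg; split=> [[w ->]|[w ->]].
  exists (\row_j (w 0 (lift r j) - w 0 r * e * u 0 (lift r j))).
  have -> : \sum_j w 0 j *: g j
      = \sum_j w 0 j *: g j - (w 0 r * e) *: \sum_j u 0 j *: g j.
    by rewrite hu scaler0 subr0.
  rewrite scaler_sumr -sumrB (bigD1_ord r) //= scalerA -mulrA eu mulr1 subrr.
  by rewrite add0r; apply: eq_bigr => j _; rewrite mxE scalerA -scalerBl.
exists (\row_j if unlift r j is Some k then w 0 k else 0).
rewrite (bigD1_ord r) //= mxE unlift_none scale0r add0r.
by apply: eq_bigr => j _; rewrite mxE liftK.
Qed.

(** The first coordinates of [K] form a finitely generated ideal; lifts of its generators, together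
    with generators of the part of [K] with first coordinate zero, generate [K]. *)
Lemma submodule_row_fg n (K : set 'rV[R]_n) : noetherian R -> submodule K ->
  exists c (g : 'I_c -> 'rV_n), generates g K.
Proof.
move=> noe; elim: n K => [|n IH] K [K0 KD KZ].
  exists 0%N, (fun=> 0) => v.
  split=> _; last by rewrite [v]thinmx0 -(thinmx0 0).
  by exists 0; rewrite [v]thinmx0 big_ord0.
pose I : set R := fun a => exists2 u, K u & u 0 ord0 = a.
have hI : is_ideal I.
  split; first by exists 0; rewrite ?mxE.
    by move=> a c [u Ku <-] [v Kv <-]; exists (u + v); [apply: KD|rewrite mxE].
  by move=> r a [u Ku <-]; exists (r *: u); [apply: KZ|rewrite mxE].
have [s Is] := noe _ hI.
have [f hf] : exists f : 'I_(size s) -> 'rV[R]_n.+1,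
    forall i, K (f i) /\ f i 0 ord0 = s`_i.
  apply: (fin_all_exists
    (P := fun (i : 'I_(size s)) u => K u /\ u 0 ord0 = s`_i)) => i.
  have : I s`_i by rewrite Is; apply: mem_ideal_span; apply: mem_nth.
  by case=> u; exists u.
pose emb (u : 'rV[R]_n) : 'rV[R]_n.+1 := row_mx (0 : 'rV_1) u.
have embD u v : emb (u + v) = emb u + emb v.
  by rewrite /emb (add_row_mx (0 : 'rV_1)) addr0.
have embZ a u : emb (a *: u) = a *: emb u.
  by rewrite /emb (scale_row_mx a (0 : 'rV_1)) scaler0.
have emb0 : emb 0 = 0 by exact: (@row_mx0 R 1 1 n).
have [|c [g hg]] := IH (fun u => K (emb u)).
  split; first by rewrite emb0.
  - by move=> u v; rewrite embD; apply: KD.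
  - by move=> a u; rewrite embZ; apply: KZ.
have KS (T : finType) (F : T -> 'rV_n.+1) (a : T -> R) :
    (forall i, K (F i)) -> K (\sum_i a i *: F i).
  by move=> hF; apply: big_ind => // i _; apply: KZ.
have Kg i : K (emb (g i)).
  apply/hg; exists (delta_mx 0 i); rewrite (bigD1 i) //= mxE !eqxx scale1r.
  by rewrite big1 ?addr0 // => j /negPf ji; rewrite mxE ji andbF scale0r.
exists (size s + c)%N,
  (fun i => match split i with inl j => f j | inr j => emb (g j) end).
move=> v; split=> [Kv|[u ->]]; last first.
  by apply: KS => i; case: (split i) => j; [case: (hf j)|].
have : I (v 0 ord0) by exists v.
rewrite Is => -[a ha].
pose w := v - \sum_i a i *: f i.
have Kw : K w.
  apply: KD => //; rewrite -scaleN1r; apply: KZ.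
  by apply: KS => i; case: (hf i).
have w0 : w = emb (rsubmx (w : 'rV_(1 + n))).
  apply: etrans (esym (hsubmxK (w : 'rV_(1 + n)))) _; congr row_mx.
  apply/rowP => i; rewrite !mxE ord1.
  have -> : lshift n (0 : 'I_1) = ord0 by apply: val_inj.
  rewrite ha summxE; apply/eqP; rewrite subr_eq0; apply/eqP.
  by apply: eq_bigr => j _; rewrite mxE; case: (hf j) => _ ->.
rewrite w0 in Kw; move/hg: Kw => [u hu].
exists (row_mx (\row_i a i) u); rewrite big_split_ord /=.
have -> : v = \sum_i a i *: f i + w by rewrite /w addrC subrK.
congr (_ + _).
  by apply: eq_bigr => i _; rewrite row_mxEl mxE (unsplitK (inl _ _)).
rewrite w0 hu; have -> : emb (\sum_i u 0 i *: g i) = \sum_i u 0 i *: emb (g i).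
  rewrite (big_morph emb embD emb0).
  by apply: eq_bigr => i _; rewrite embZ.
by apply: eq_bigr => i _; rewrite row_mxEr (unsplitK (inr _ _)).
Qed.

Lemma minimal_presentation (m : set R) n (K : set 'rV[R]_n) :
  noetherian R -> local_at m -> submodule K ->
  exists c (D : 'M_(c, n)), (forall u, K u <-> exists w, u = w *m D) /\
    forall w : 'rV_c, w *m D = 0 -> mxin m w.
Proof.
move=> noe hm /(submodule_row_fg noe)[c0 [g0 h0]].
have [c [g [hg gm]]] := minimal_generators hm h0.
have gE (w : 'rV_c) : w *m \matrix_i g i = \sum_i w 0 i *: g i.
  by rewrite mulmx_sum_row; apply: eq_bigr => i _; rewrite rowK.
exists c, (\matrix_i g i); split=> [u|w]; last by rewrite gE; apply: gm.
by rewrite hg; split=> -[w hw]; exists w; rewrite gE in hw *.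
Qed.

(* Keeps the rank in degree 0 convertible to the given [c]. *)
Definition rank_cons (c : nat) (b : nat -> nat) i :=
  if i is j.+1 then b j else c.

(** Minimality: the rows of [d i.+1] are relations among the minimal generators that are the rows of
    [d i], so they lie in [m]; for [d 0] this is the assumption on [K]. *)
Lemma minimal_free_resolution (m : set R) n (K : set 'rV[R]_n) :
  noetherian R -> local_at m -> submodule K -> (forall u, K u -> mxin m u) ->
  exists b (d : forall i, 'M[R]_(rank_cons n b i.+1, rank_cons n b i)),
    [/\ forall u : 'rV_n, K u <-> exists w, u = w *m d 0%N,
        forall i (u : 'rV_(rank_cons n b i.+1)),
          u *m d i = 0 <-> exists w, u = w *m d i.+1
      & forall i, mxin m (d i)].
Proof.
move=> noe hm hK Km.
have [c [D [hD Dm]]] := minimal_presentation noe hm hK.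
pose next a e f (A : 'M[R]_(a, e)) (B : 'M[R]_(f, a)) :=
  (forall u : 'rV_a, u *m A = 0 <-> exists w, u = w *m B) /\
  (forall w : 'rV_f, w *m B = 0 -> mxin m w).
have nextP a e (A : 'M[R]_(a, e)) :
    {x : {f & 'M[R]_(f, a)} | next _ _ _ A (tagged x)}.
  apply: cid.
  have [|f [B hB]] := @minimal_presentation m a (fun u => u *m A = 0) noe hm.
    split; first by rewrite mul0mx.
      by move=> u v hu hv; rewrite mulmxDl hu hv addr0.
    by move=> r u hu; rewrite -scalemxAl hu scaler0.
  by exists (Tagged (fun f => 'M[R]_(f, a)) B).
(* The ranks arise together with the matrices, so the recursion runs on a matrix packed with its two
   sizes. *)
pose stage := {e & {a & 'M[R]_(a, e)}}.
pose st := fix st i : stage := if i is j.+1 then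
    existT _ (tag (tagged (st j))) (sval (nextP _ _ (tagged (tagged (st j)))))
  else existT _ n (existT _ c D).
pose b i := tag (st i.+1).
pose d i : 'M[R]_(rank_cons n b i.+1, rank_cons n b i) :=
  if i is j.+1 then tagged (tagged (st j.+1)) else D.
have dn i : next _ _ _ (d i) (d i.+1).
  by case: i => [|i]; apply: svalP (nextP _ _ _).
have dker i (w : 'rV_(rank_cons n b i.+1)) : w *m d i = 0 -> mxin m w.
  by case: i w => [|i] w; [apply: Dm|apply: (dn i).2].
have rowm k l (A : 'M_(k, l)) : (forall i, mxin m (row i A)) -> mxin m A.
  by move=> h i j; have := h i 0 j; rewrite mxE.
exists b, d; split=> [//|i u|[|i]]; first exact: (dn i).1.
  by apply: rowm => i; apply: Km; apply/hD; exists (delta_mx 0 i); rewrite rowE.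
apply: rowm => j; apply: (dker i); apply/(dn i).1.
by exists (delta_mx 0 j); rewrite rowE.
Qed.

End FreeResolutions.

(** * Independence of Ext from the resolution *)

Section ImageModule.
Variables (R : comNzRingType) (A B : lmodType R) (f : {linear A -> B}).

(** The image is made a module so that [projective], which speaks of surjections, can lift maps that
    merely land in an image. *)
Definition image_pred : {pred B} := fun y => `[< exists x, f x = y >].

Lemma image_pred_submod : submod_closed image_pred.
Proof.
split=> [|a u v]; first by apply/asboolP; exists 0; rewrite raddf0.
move=> /asboolP[x <-] /asboolP[y <-]; apply/asboolP; exists (a *: x + y).
by rewrite linearP.
Qed.

HB.instance Definition _ :=
  GRing.isSubmodClosed.Build R B image_pred image_pred_submod.

Record image_module := ImageModule { im_val : B; _ : im_val \in image_pred }.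

HB.instance Definition _ := [isSub for im_val].
HB.instance Definition _ := [Choice of image_module by <:].
HB.instance Definition _ := [SubChoice_isSubLmodule of image_module by <:].

End ImageModule.

Section Comparison.
Variable R : comNzRingType.
Implicit Types A B M N P : lmodType R.

Lemma linear_pack A B (f : A -> B) :
  linear f -> exists g : {linear A -> B}, forall x, g x = f x.
Proof.
move=> hf.
pose F := GRing.isLinear.Build R A B _ f hf.
pose G : {linear A -> B} := HB.pack f F.
by exists G.
Qed.

Lemma projective_lift P A B (d : {linear A -> B}) (f : {linear P -> B}) :
  projective P -> (forall y, exists x, d x = f y) ->
  exists g : {linear P -> A}, forall y, d (g y) = f y.
Proof.
move=> hP hf.
have dI x : d x \in image_pred d by apply/asboolP; exists x.
have fI y : f y \in image_pred d by apply/asboolP.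
pose d0 x : image_module d := ImageModule (dI x).
pose f0 y : image_module d := ImageModule (fI y).
have [|d1 hd1] := @linear_pack _ _ d0.
  by move=> a u v; apply: val_inj; rewrite /= !linearP.
have [|f1 hf1] := @linear_pack _ _ f0.
  by move=> a u v; apply: val_inj; rewrite /= !linearP.
have [|g hg] := hP _ _ d1 f1.
  move=> [z hz]; have /asboolP[x hx] := hz; exists x.
  by apply: val_inj; rewrite hd1.
by exists g => y; have /(congr1 val) := hg y; rewrite hd1 hf1.
Qed.

Lemma free_projective n : projective 'rV[R]_n.
Proof.
move=> A B p f hp.
have [a ha] := fin_all_exists (fun i : 'I_n => hp (f (delta_mx 0 i))).
have [|g hg] := @linear_pack 'rV[R]_n A (fun u => \sum_i u 0 i *: a i).
  move=> c u v; rewrite scaler_sumr -big_split; apply: eq_bigr => i _ /=.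
  by rewrite !mxE scalerDl scalerA.
exists g => u; rewrite hg {2}[u]row_sum_delta !linear_sum.
by apply: eq_bigr => i _; rewrite !linearZ /= ha.
Qed.

Section Homotopy.
Variables (M : lmodType R) (P Q : projective_resolution M).

(* [al : Q -> P], [be : P -> Q] are chain maps over the identity of [M], and
   [s] a homotopy from the identity of [Q] to [be al], in two consecutive
   degrees. *)
Lemma comparison i : exists (al0 : {linear Q i -> P i})
    (al1 : {linear Q i.+1 -> P i.+1}) (be0 : {linear P i -> Q i})
    (be1 : {linear P i.+1 -> Q i.+1})
    (s0 : {linear Q i -> Q i.+1}) (s1 : {linear Q i.+1 -> Q i.+2}),
  [/\ forall y, pr_diff P i (al1 y) = al0 (pr_diff Q i y),
      forall y, pr_diff Q i (be1 y) = be0 (pr_diff P i y) &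
      forall y, be1 (al1 y) - y = pr_diff Q i.+1 (s1 y) + s0 (pr_diff Q i y)].
Proof.
have lin N N' N'' (f : {linear N' -> N''}) (g : {linear N -> N'}) :
    exists h : {linear N -> N''}, forall y, h y = f (g y).
  by exists (f \o g).
have homo N N' (f : {linear N' -> N}) (g : {linear N -> N'})
      (k : {linear N -> N}) :
    exists h : {linear N -> N}, forall y, h y = f (g y) - y - k y.
  by exists ((f \o g) \- idfun \- k).
have augQ0 y : pr_aug Q (pr_diff Q 0 y) = 0 by apply/pr_exact0; exists y.
have augP0 y : pr_aug P (pr_diff P 0 y) = 0 by apply/pr_exact0; exists y.
have dQ0 j y : pr_diff Q j (pr_diff Q j.+1 y) = 0 by apply/pr_exactS; exists y.
have dP0 j y : pr_diff P j (pr_diff P j.+1 y) = 0 by apply/pr_exactS; exists y.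
elim: i => [|i [al0 [al1 [be0 [be1 [s0 [s1 [hal hbe hs]]]]]]]].
  have [al0 hal0] := projective_lift (d := pr_aug P) (f := pr_aug Q)
    (@pr_projective _ _ Q 0)
    (fun=> @pr_aug_surj _ _ P _).
  have [be0 hbe0] := projective_lift (d := pr_aug Q) (f := pr_aug P)
    (@pr_projective _ _ P 0)
    (fun=> @pr_aug_surj _ _ Q _).
  have [f hf] := lin _ _ _ al0 (pr_diff Q 0).
  have [|al1 hal1] := projective_lift (d := pr_diff P 0) (f := f)
    (@pr_projective _ _ Q 1).
    by move=> y; apply/pr_exact0; rewrite hf hal0.
  have [g hg] := lin _ _ _ be0 (pr_diff P 0).
  have [|be1 hbe1] := projective_lift (d := pr_diff Q 0) (f := g)
    (@pr_projective _ _ P 1).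
    by move=> y; apply/pr_exact0; rewrite hg hbe0.
  (* In degree 0 there is no earlier homotopy, hence the zero map. *)
  have [h0 hh0] := homo _ _ be0 al0 \0.
  have [|s0 hs0] := projective_lift (d := pr_diff Q 0) (f := h0)
    (@pr_projective _ _ Q 0).
    by move=> y; apply/pr_exact0; rewrite hh0 subr0 raddfB /= hbe0 hal0 subrr.
  have [h1 hh1] := homo _ _ be1 al1 (s0 \o pr_diff Q 0).
  have [|s1 hs1] := projective_lift (d := pr_diff Q 1) (f := h1)
    (@pr_projective _ _ Q 1).
    move=> y; apply/pr_exactS.
    by rewrite hh1 !raddfB /= hbe1 hg hal1 hf hs0 hh0 subr0 subrr.
  exists al0, al1, be0, be1, s0, s1; split=> y.
  - by rewrite hal1 hf.
  - by rewrite hbe1 hg.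
  - by rewrite hs1 hh1 subrK.
have [f hf] := lin _ _ _ al1 (pr_diff Q i.+1).
have [|al2 hal2] := projective_lift (d := pr_diff P i.+1) (f := f)
  (@pr_projective _ _ Q i.+2).
  by move=> y; apply/pr_exactS; rewrite hf hal dQ0 raddf0.
have [g hg] := lin _ _ _ be1 (pr_diff P i.+1).
have [|be2 hbe2] := projective_lift (d := pr_diff Q i.+1) (f := g)
  (@pr_projective _ _ P i.+2).
  by move=> y; apply/pr_exactS; rewrite hg hbe dP0 raddf0.
have [h hh] := homo _ _ be2 al2 (s1 \o pr_diff Q i.+1).
have [|s2 hs2] := projective_lift (d := pr_diff Q i.+2) (f := h)
  (@pr_projective _ _ Q i.+2).
  move=> y; apply/pr_exactS; rewrite hh !raddfB /= hbe2 hg hal2 hf.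
  by rewrite hs dQ0 raddf0 addr0 subrr.
exists al1, al2, be1, be2, s1, s2; split=> y.
- by rewrite hal2 hf.
- by rewrite hbe2 hg.
- by rewrite hs2 hh subrK.
Qed.

End Homotopy.

(** [Ext_vanishes] provides some resolution [P]; vanishing is moved to [Q] by pulling [f] back along
    [be1]. The homotopy changes the cocycle [f] only by [f s0 d], a coboundary. *)
Lemma Ext_vanishes_resolution i M N (Q : projective_resolution M) :
  Ext_vanishes i.+1 M N ->
  forall f : {linear Q i.+1 -> N}, ext_cocycle f -> ext_coboundary f.
Proof.
move=> [P hP] f hf.
have [al0 [al1 [be0 [be1 [s0 [s1 [hal hbe hs]]]]]]] := comparison P Q i.
have [y|g hg] := hP (f \o be1).
  have /pr_exactS[z hz] : pr_diff Q i (be1 (pr_diff P i.+1 y)) = 0.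
    have h : pr_diff P i (pr_diff P i.+1 y) = 0 by apply/pr_exactS; exists y.
    by rewrite hbe h raddf0.
  by rewrite /= -hz; apply: hf.
exists ((g \o al0) \- (f \o s0)) => y /=.
have := hg (al1 y); rewrite /= hal => <-.
have -> : be1 (al1 y) = y + pr_diff Q i.+1 (s1 y) + s0 (pr_diff Q i y).
  by rewrite -addrA -hs addrC subrK.
by rewrite !raddfD /= hf addr0 addrK.
Qed.

End Comparison.

(** * Lengths of regular sequences *)

Section Depth.
Variable R : comNzRingType.

Lemma mxin_span_nil m n (A : 'M[R]_(m, n)) : mxin (ideal_span [::]) A <-> A = 0.
Proof.
split=> [h|->]; last exact: mxin0 (ideal_span_is_ideal _) _ _.
by apply/matrixP => i j; have [c ->] := h i j; rewrite big_ord0 mxE.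
Qed.

Section Complex.
Variables (b : nat -> nat) (d : forall i, 'M[R]_(b i.+1, b i)).
Hypothesis dker : forall i (u : 'rV_(b i.+1)),
  u *m d i = 0 <-> exists w, u = w *m d i.+1.

Lemma row_factor p k l (D : 'M[R]_(k, l)) (A : 'M_(p, l)) :
  (forall i, exists w, row i A = w *m D) -> exists W, A = W *m D.
Proof.
move=> /fin_all_exists[w hw]; exists (\matrix_i w i).
by apply/row_matrixP => i; rewrite row_mul rowK.
Qed.

Lemma exact_rows i p (A : 'M_(p, b i.+1)) :
  A *m d i = 0 -> exists W, A = W *m d i.+1.
Proof.
by move=> hA; apply: row_factor => j; apply/dker; rewrite -row_mul hA row0.
Qed.

Lemma exact_comp i : d i.+1 *m d i = 0.
Proof.
apply/row_matrixP => j; rewrite row_mul row0; apply/dker.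
by exists (delta_mx 0 j); rewrite rowE.
Qed.

Lemma exact_mod_nil i : exact_mod d (ideal_span [::]) i.
Proof.
move=> c u /mxin_span_nil/exact_rows[w ->]; exists w.
by apply/mxin_span_nil; rewrite subrr.
Qed.

Section NullHomotopy.
Variable m : set R.
Hypothesis hm : is_ideal m.
Hypothesis dm : forall u : 'rV_(b 0), mxin m u <-> exists w, u = w *m d 0.

Lemma null_homotopy0 x : m x -> exists h, x%:M = h *m d 0.
Proof.
move=> mx; apply: row_factor => i; apply/dm => j k; rewrite !mxE.
by case: eqP => _; rewrite ?mulr1n ?mulr0n //; apply: ideal0.
Qed.

(** Multiplication by [x] is zero on the resolved module, hence null-homotopic; each new map is a
    lift of what the previous one leaves over. *)
Lemma null_homotopy x i : m x ->
  exists h h', x%:M = h' *m d i.+1 + d i *m h.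
Proof.
move=> mx; have step j (h : 'M_(b j, b j.+1)) :
    (x%:M - d j *m h) *m d j = 0 -> exists h', x%:M = h' *m d j.+1 + d j *m h.
  by move=> /exact_rows[h' e]; exists h'; rewrite -e subrK.
elim: i => [|i [h [h' e]]].
  have [h e] := null_homotopy0 mx; exists h; apply: step.
  by rewrite mulmxBl -mulmxA -e mul_scalar_mx mul_mx_scalar subrr.
exists h'; apply: step; rewrite mulmxBl -mulmxA.
have -> : h' *m d i.+1 = x%:M - d i *m h by rewrite e addrK.
rewrite mulmxBr mulmxA exact_comp mul0mx subr0.
by rewrite mul_scalar_mx mul_mx_scalar subrr.
Qed.

(* [Ext^i(R/m, R/Z) = 0], computed from the resolution [d] of [R/m]. *)
Definition Ext_residue_mod (Z : set R) i : Prop :=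
  if i is j.+1 then Ext_ring_mod d Z j
  else forall c (v : 'M_(b 0, c)), mxin Z (d 0 *m v) -> mxin Z v.

(** Induction on [i]: the next element of [s] annihilates [Ext^i(R/m, R/Z)] by the null homotopy,
    and acts injectively on it because the preceding [Ext] vanishes after that element is adjoined
    to [Z]. *)
Lemma Ext_residue_regular (s : seq R) k i : regular_seq s ->
  (forall a, a \in s -> m a) -> (k + i < size s)%N ->
  Ext_residue_mod (ideal_span (take k s)) i.
Proof.
move=> [regs _] sm; elim: i k => [|i IH] k hk /= c v hv.
  rewrite addn0 in hk; have hZ := ideal_span_is_ideal (take k s).
  have [h e] := null_homotopy0 (sm _ (mem_nth 0 hk)).
  apply: (mxin_cancel (regs _ hk)).
  by rewrite -mul_scalar_mx e -mulmxA; apply: mxinMl.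
have hk' : (k < size s)%N by lia.
have hZ := ideal_span_is_ideal (take k s).
have [h [h' e]] := null_homotopy i (sm _ (mem_nth 0 hk')).
pose w := h *m v.
have xv : mxin (ideal_span (take k s)) (s`_k *: v - d i *m w).
  rewrite -mul_scalar_mx e mulmxDl -!mulmxA addrK.
  exact: mxinMl.
(* [w] is a cocycle once [s]_k[is adjoined; the induction hypothesis makes it a coboundary plus a
   multiple of]s[_k], up to [Z]. *)
suff [u hu] : exists u,
    mxin (ideal_span (take k s)) (d i *m w - s`_k *: (d i *m u)).
  exists u; apply: (mxin_cancel (regs _ hk')).
  have -> : s`_k *: (v - d i *m u)
    = (s`_k *: v - d i *m w) + (d i *m w - s`_k *: (d i *m u)) by mxring.
  exact: mxinD.
have := IH k.+1; rewrite addSnnS => /(_ hk); rewrite ideal_span_take //.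
have dw : mxin (adjoin_ideal (ideal_span (take k s)) s`_k) (d i *m w).
  by apply: (mxin_adjoinI (B := v)); rewrite -opprB; apply: mxinN.
move: (w) dw => {xv w h h' e}; case: (i) => [|j] w dw /= E.
  have /mxin_adjoin[u hu] := E _ _ dw; exists u.
  by rewrite scalemxAr -mulmxBr; apply: mxinMl.
have [y /mxin_adjoin[u hu]] := E _ _ dw; exists u.
have -> : d j.+1 *m w - s`_k *: (d j.+1 *m u)
  = d j.+1 *m (w - d j *m y - s`_k *: u).
  by rewrite !mulmxBr mulmxA exact_comp mul0mx subr0 scalemxAr.
exact: mxinMl.
Qed.

End NullHomotopy.
End Complex.

(* [Ext^1(k, R/Z)] is nonzero because the projection of [m/Z] onto [J/Z] is not
   multiplication by an element of [R/Z]. *)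
Lemma Ext_residue_fiber_product b
    (d : forall i, 'M[R]_(rank_cons 1 b i.+1, rank_cons 1 b i))
    (m Z I J : set R) : local_at m -> is_ideal Z -> splits_mod m Z I J ->
  (forall i, d i.+1 *m d i = 0) ->
  (forall u : 'rV_1, mxin m u <-> exists w, u = w *m d 0%N) ->
  (exists2 a, I a & ~ Z a) -> (exists2 a, J a & ~ Z a) ->
  ~ Ext_ring_mod d Z 0.
Proof.
move=> hm hZ IJ dd d0 [i Ii nZi] [j Jj nZj] E.
have mi : is_ideal m by case: hm.
have [[hI hJ] ZIJ _ IJm _] := IJ.
have dm : mxin m (d 0%N).
  move=> s t; have : mxin m (row s (d 0%N)).
    by apply/d0; exists (delta_mx 0 s); rewrite rowE.
  by move=> /(_ 0 t); rewrite mxE.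
have [B [C [hB hC dBC]]] := mxin_split IJ dm.
have [_ /E[u hu]] : mxin Z (d 1%N *m B) /\ mxin Z (d 1%N *m C).
  apply: (mxin_split_cancel hZ IJ); try exact: mxinMl.
  by rewrite -mulmxDr -dBC dd; apply: mxin0.
have gen a : m a -> exists w : 'rV_(rank_cons 1 b 1),
   a = (w *m B) 0 0 + (w *m C) 0 0 /\ Z ((w *m C) 0 0 - a * u 0 0).
  move=> ma; have [|w hw] := (d0 a%:M).1.
    by move=> s t; rewrite !ord1 mxE eqxx mulr1n.
  have aE : a = (w *m B) 0 0 + (w *m C) 0 0.
    transitivity ((w *m d 0%N) 0 0); last by rewrite dBC mulmxDr mxE.
    by rewrite -hw mxE eqxx mulr1n.
  exists w; split=> //.
  have -> : (w *m C) 0 0 - a * u 0 0 = (w *m (C - d 0%N *m u)) 0 0.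
    by rewrite mulmxBr mulmxA -hw mul_scalar_mx !mxE.
  exact: mxinMl.
(* The projection onto [J] is multiplication by [u]: it fixes [j], so [j (1 - u)] lies in [Z], and
   kills [i], so [i u] lies in [Z]. One of [1 - u] and [u] is a unit. *)
have [um|um] := pselect (m (u 0 0)).
  have [w [jE hw]] := gen j (IJm _ (or_intror Jj)).
  have [|||wB _] := split_cancel hZ IJ (a := (w *m B) 0 0)
      (c := (w *m C) 0 0 - j).
  - exact: mxinMl.
  - by apply: idealB => //; apply: mxinMl.
  - by rewrite addrA -jE subrr; apply: ideal0.
  apply: nZj; apply: (local_at_cancel (a := 1 - u 0 0) hm) => //.
    case: (hm) => _ m1 _ h1; apply: m1; rewrite -[1](subrK (u 0 0)).
    exact: idealD.
  have -> : j * (1 - u 0 0) = (w *m B) 0 0 + ((w *m C) 0 0 - j * u 0 0).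
    by rewrite mulrBr mulr1 {1}jE addrA.
  exact: idealD.
have [w [iE hw]] := gen i (IJm _ (or_introl Ii)).
have [|||_ wC] := split_cancel hZ IJ (a := (w *m B) 0 0 - i)
    (c := (w *m C) 0 0).
- by apply: idealB => //; apply: mxinMl.
- exact: mxinMl.
- by rewrite addrAC -iE subrr; apply: ideal0.
apply: nZi; apply: (local_at_cancel hm hZ um).
rewrite -[i * _](subKr ((w *m C) 0 0)).
exact: idealB.
Qed.

(** With [n = size x], length [n + 2] or more would make [Ext^i(R/m, R)] vanish for
    [1 <= i <= n + 1]; descending along [x] would leave [Ext^1(R/m, R/(x)) = 0]. *)
Lemma regular_seq_bound (x s : seq R) (m I J : set R) :
  noetherian R -> local_at m -> regular_seq x ->
  splits_mod m (ideal_span x) I J ->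
  (exists2 a, I a & ~ ideal_span x a) -> (exists2 a, J a & ~ ideal_span x a) ->
  regular_seq s -> (forall a, a \in s -> m a) -> (size s <= (size x).+1)%N.
Proof.
move=> noe hm [regx _] IJ nI nJ regs sm; rewrite leqNgt; apply/negP => ss.
have mi : is_ideal m by case: hm.
have [||b [d [d0 dker _]]] :=
  @minimal_free_resolution R m 1 (@mxin R m 1 1) noe hm.
- by split; [apply: mxin0|apply: mxinD|move=> *; apply: mxinZ].
- by [].
have dd := exact_comp dker.
have hZ := ideal_span_is_ideal x.
apply: (Ext_residue_fiber_product hm hZ IJ dd d0 nI nJ).
rewrite -[x](take_size x); apply: Ext_ring_mod_take => // j hj.
have := Ext_residue_regular (k := 0) (i := j.+1) dker mi d0 regs sm.
by rewrite take0; apply; lia.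
Qed.

(** The bound yields a longest regular sequence, so [depth R] is a true maximum and not the default
    of [xget]. *)
Lemma depth_regular_seq (x : seq R) (m I J : set R) :
  noetherian_local R -> maximal_ideal m -> regular_seq x ->
  splits_mod m (ideal_span x) I J ->
  (exists2 a, I a & ~ ideal_span x a) -> (exists2 a, J a & ~ ideal_span x a) ->
  (forall a, a \in x -> m a) -> (size x <= depth R)%N.
Proof.
move=> hR mm regx IJ nI nJ xm.
have hm := noetherian_local_at hR mm.
have [noe [m0 [_ um]]] := hR; have e := um _ mm; subst m0.
have bound (s : seq R) : regular_seq_in_maximal s -> (size s <= (size x).+1)%N.
  move=> [regs [m' hm' sm]]; have e := um _ hm'; subst m'.
  by apply: (regular_seq_bound noe hm regx IJ).
have xreg : regular_seq_in_maximal x by split=> //; exists m.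
have ex : exists k, `[< exists2 s, @regular_seq_in_maximal R s & size s = k >].
  by exists (size x); apply/asboolP; exists x.
have ub k : `[< exists2 s, @regular_seq_in_maximal R s & size s = k >] ->
    (k <= (size x).+1)%N by move=> /asboolP[s /bound + <-].
case: (ex_maxnP ex ub) => k /asboolP hk kmax.
have : is_depth R (depth R).
  apply: (@xgetPex _ 0%N [set d | is_depth R d]%classic).
  by exists k; split=> // s hs; apply: kmax; apply/asboolP; exists s.
by case=> _; apply.
Qed.

End Depth.

(** * Quasi-fiber product rings *)

Section QuasiFiberProduct.
Local Open Scope classical_set_scope.
Local Open Scope quotient_scope.
Variable R : comNzRingType.

Lemma kernel_maximal (k : fieldType) (phi : {rmorphism R -> k}) :
  (forall a, exists r, phi r = a) -> maximal_ideal [set r | phi r = 0].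
Proof.
move=> surj; split.
- split=> /=; first exact: rmorph0.
    by move=> a c ha hc; rewrite rmorphD ha hc addr0.
  by move=> r a ha; rewrite rmorphM ha mulr0.
- apply/eqP => /seteqP[_ /(_ 1 Logic.I)] /= /eqP.
  by rewrite rmorph1 oner_eq0.
move=> J hJ JT kJ; apply/seteqP; split=> // a Ja /=.
apply: contrapT => /eqP na; apply: (proper_ideal1 hJ JT).
have [c hc] := surj (phi a)^-1.
rewrite -[1](subrK (c * a)); apply: idealD => //; last exact: idealMl.
by apply: kJ; rewrite /= rmorphB rmorphM rmorph1 hc mulVf // subrr.
Qed.

(** The map [q] from [R] to [S * T] has kernel [(x)]; [I] and [J] are the elements with zero
    component in [T] and in [S]. Non-injectivity of [piS] and [piT] gives nonzero pairs [(s, 0)] and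
    [(0, t)] in the fiber product. *)
Lemma quasi_fiber_product_splits n (x : n.-tuple R) :
  quasi_fiber_product_ring x -> exists m I J,
    [/\ maximal_ideal m, splits_mod m (ideal_span x) I J,
        exists2 a, I a & ~ ideal_span x a & exists2 a, J a & ~ ideal_span x a].
Proof.
move=> [_ _ [Q [QE [_ [S [T [k [piS [piT H]]]]]]]]].
case: H => _ [sS sT] [iS iT] [f [g fK gK]].
pose q r : S * T := val (f (\pi_{ideal_quot Q} r)).
have qB r s : q (r - s) = q r - q s by rewrite /q !rmorphB.
have qM r s : q (r * s) = q r * q s by rewrite /q !rmorphM.
have qk r : piS (q r).1 = piT (q r).2 by apply/eqP; apply: (valP (f _)).
have qZ r : q r = 0 <-> ideal_span x r.
  rewrite -QE /=; split=> [qr|rQ].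
    have /(congr1 g) : f (\pi_{ideal_quot Q} r) = f 0.
      by apply: val_inj; rewrite [LHS]qr rmorph0.
    rewrite !fK => /eqP; rewrite -(rmorph0 \pi_{ideal_quot Q}).
    by rewrite -Quotient.idealrBE subr0.
  have -> : r = r - 0 by rewrite subr0.
  rewrite qB; apply/eqP; rewrite subr_eq0; apply/eqP; rewrite /q.
  congr (val (f _)); apply/eqP; rewrite -Quotient.idealrBE subr0; exact: rQ.
have qsurj s t : piS s = piT t -> exists r, q r = (s, t).
  move=> /eqP st.
  pose p := FiberProd (piS := piS) (piT := piT) (fp_val := (s, t)) st.
  exists (repr (g p)).
  by rewrite /q reprK gK.
pose phi : {rmorphism R -> k} :=
  piS \o (fst \o (val \o (f \o \pi_{ideal_quot Q}))).
have phiE r : phi r = piS (q r).1 by [].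
have q0 : q 0 = 0 by apply/qZ; apply: ideal0 (ideal_span_is_ideal x).
have qD r s : q (r + s) = q r + q s by rewrite /q !rmorphD.
have noninj (A : comNzRingType) (p : {rmorphism A -> k}) :
    ~ injective p -> exists2 a, p a = 0 & a != 0.
  move=> ninj; apply: contrapT => h; apply: ninj => a c pac.
  apply/eqP; rewrite -subr_eq0; apply: contrapT => /negP ac.
  by apply: h; exists (a - c) => //; rewrite rmorphB pac subrr.
exists [set r | phi r = 0], [set r | (q r).2 = 0], [set r | (q r).1 = 0]; split.
- apply: kernel_maximal => a; have [s sa] := sS a; have [t ta] := sT a.
  have [|r hr] := qsurj s t; first by rewrite sa ta.
  by exists r; rewrite phiE hr.
- split=> /=.
  + split; split=> /=; rewrite ?q0 //.
    * by move=> a c; rewrite qD /= => -> ->; rewrite addr0.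
    * by move=> r a; rewrite qM /= => ->; rewrite mulr0.
    * by move=> a c; rewrite qD /= => -> ->; rewrite addr0.
    * by move=> r a; rewrite qM /= => ->; rewrite mulr0.
  + by move=> a /qZ ->.
  + move=> a qa; change (piS (q a).1 = 0) in qa.
    have [|i hi] := qsurj (q a).1 0; first by rewrite qa rmorph0.
    exists i, (a - i); rewrite qB hi /= subrr; split=> //.
    by rewrite addrC subrK.
  + by move=> a qa; change (piS (q a).1 = 0); case: qa => [qa|->];
      rewrite ?qk ?qa rmorph0.
  + by move=> a qa2 qa1; apply/qZ; case: (q a) qa1 qa2 => ? ? /= -> ->.
- have [s ps s0] := noninj _ _ iS; have [|r hr] := qsurj s 0.
    by rewrite ps rmorph0.
  exists r; rewrite /= ?hr // => /qZ; rewrite hr => -[s00].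
  by rewrite s00 eqxx in s0.
have [t pt t0] := noninj _ _ iT; have [|r hr] := qsurj 0 t.
  by rewrite pt rmorph0.
exists r; rewrite /= ?hr // => /qZ; rewrite hr => -[t00].
by rewrite t00 eqxx in t0.
Qed.

End QuasiFiberProduct.

(** * From vanishing of Ext to matrix conditions *)

Section MinimalResolution.
Variables (R : comNzRingType) (M : lmodType R).
Variables (c : nat) (e : {linear 'rV[R]_c -> M}).
Variables (b : nat -> nat)
  (d : forall i, 'M[R]_(rank_cons c b i.+1, rank_cons c b i)).
Hypothesis esurj : forall y, exists u, e u = y.
Hypothesis eker : forall u, e u = 0 <-> exists w, u = w *m d 0.
Hypothesis dker : forall i (u : 'rV_(rank_cons c b i.+1)),
  u *m d i = 0 <-> exists w, u = w *m d i.+1.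

Definition matrix_resolution : projective_resolution M.
Proof.
refine (@ProjectiveResolution R M (fun i => 'rV[R]_(rank_cons c b i))
  (fun i => mulmxr (d i)) e _ esurj _ _).
- by move=> i; apply: free_projective.
- by move=> u; rewrite eker; split=> -[w hw]; exists w.
- by move=> i u; rewrite /= dker; split=> -[w hw]; exists w.
Defined.

Lemma linear_row_sum (N : lmodType R) k (f : {linear 'rV[R]_k -> N}) u :
  f u = \sum_j u 0 j *: f (delta_mx 0 j).
Proof.
rewrite {1}[u]row_sum_delta linear_sum.
by apply: eq_bigr => j _; rewrite linearZ.
Qed.

(** Each column of [v] is a cocycle into the factor [R]; the second components of the bounding map
    form a column of the required matrix. *)
Lemma Ext_vanishes_ring i :
  Ext_vanishes i.+1 M (M * R^o)%type -> Ext_ring_mod d (ideal_span [::]) i.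
Proof.
move=> /(Ext_vanishes_resolution (Q := matrix_resolution)) E k v.
move=> /mxin_span_nil dv.
have col_lift (l : 'I_k) : exists w : 'I_(rank_cons c b i) -> R,
    forall j, v j l = \sum_s d i j s * w s.
  have [|f hf] := @linear_pack R 'rV[R]_(rank_cons c b i.+1) (M * R^o)%type
    (fun u => (0, (u *m v) 0 l)).
    move=> a u u'; rewrite mulmxDl -scalemxAl !mxE.
    by congr pair; rewrite /= scaler0 addr0.
  have [u|g hg] := E f.
    by rewrite hf /= -mulmxA dv mulmx0 mxE.
  exists (fun s => (g (delta_mx 0 s)).2) => j.
  have := hg (delta_mx 0 j); rewrite hf /= -!rowE => /(congr1 snd) /=.
  rewrite mxE => ->; rewrite linear_row_sum.
  rewrite (big_morph snd (id1 := 0) (op1 := +%R)) //.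
  by apply: eq_bigr => s _; rewrite mxE.
have [w hw] := fin_all_exists col_lift.
exists (\matrix_(s, l) w l s); apply/mxin_span_nil/matrixP => j l.
rewrite !mxE (hw l j); apply/eqP; rewrite subr_eq0; apply/eqP.
by apply: eq_bigr => s _; rewrite mxE.
Qed.

(** [M] is the cokernel of [d 0], so [V] followed by [e] is a cocycle into the factor [M]. Lifting
    the bounding map through [e] gives [U], and the error lies in the kernel of [e], giving [U']. *)
Lemma Ext_vanishes_self i :
  Ext_vanishes i.+1 M (M * R^o)%type -> Ext_syz_mod d (ideal_span [::]) i 0.
Proof.
move=> /(Ext_vanishes_resolution (Q := matrix_resolution)) E V C.
move=> /mxin_span_nil/eqP.
rewrite subr_eq0 => /eqP dV.
have [|f hf] := @linear_pack R 'rV[R]_(rank_cons c b i.+1) (M * R^o)%type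
    (fun u => (e (u *m V), 0)).
  move=> a u u'; rewrite mulmxDl -scalemxAl linearP.
  by congr pair; rewrite /= scaler0 addr0.
have [u|g hg] := E f.
  rewrite hf /= -mulmxA dV mulmxA; congr pair; apply/eker.
  by exists (u *m C).
have [U hU] := fin_all_exists (fun s => esurj (g (delta_mx 0 s)).1).
have eU u : e (u *m \matrix_s U s) = (g u).1.
  rewrite mulmx_sum_row linear_sum linear_row_sum.
  rewrite (big_morph fst (id1 := 0) (op1 := +%R)) //.
  by apply: eq_bigr => s _; rewrite linearZ rowK /= hU.
have [U' hU'] : exists U', V - d i *m \matrix_s U s = U' *m d 0.
  apply: row_factor => j; apply/eker; rewrite rowE mulmxBr raddfB /=.
  rewrite mulmxA eU; apply/eqP; rewrite subr_eq0; apply/eqP.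
  by have := hg (delta_mx 0 j); rewrite hf /= => /(congr1 fst).
by exists (\matrix_s U s), U'; apply/mxin_span_nil; rewrite hU' subrr.
Qed.

Lemma free_module_of_rank0 : b 0 = 0%N -> free_module M.
Proof.
move=> b0; exists c, e.
have einj : injective e.
  move=> u v uv; apply/eqP; rewrite -subr_eq0; apply/eqP.
  have /eker[w ->] : e (u - v) = 0 by rewrite raddfB /= uv subrr.
  have -> : w = 0 by apply/rowP => -[j jb]; exfalso; rewrite /= b0 in jb.
  exact: mul0mx.
exists (fun y => sval (cid (esurj y))) => y; last by case: cid.
by apply: einj; case: cid.
Qed.

End MinimalResolution.

(** * Finite minimal resolutions and freeness *)

Lemma rank0_of_Ext_ring (R : comNzRingType) b
    (d : forall i, 'M[R]_(b i.+1, b i)) (m : set R) i :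
  local_at m -> (forall i, mxin m (d i)) -> b i.+1 = 0%N ->
  (forall j, (j < i)%N -> Ext_ring_mod d (ideal_span [::]) j) -> b 1 = 0%N.
Proof.
move=> [hm m1 _] dm; elim: i => [|i IH] bi G //.
apply: IH => [|j ji]; last by apply: G; apply: ltnW.
(* With [b i.+2 = 0] the identity matrix is a cocycle, hence [1 = d i *m u], whose entries lie in
   [m]; this forces [b i.+1 = 0]. *)
have [|u /mxin_span_nil/eqP] := G i (ltnSn i) _ 1%:M.
  by move=> -[j jb]; exfalso; rewrite bi in jb.
rewrite subr_eq0 => /eqP e; apply/eqP; rewrite -leqn0 leqNgt; apply/negP => b0.
pose j := Ordinal b0; apply: m1.
have -> : 1 = (d i *m u) j j by rewrite -e mxE eqxx.
exact: mxinMr.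
Qed.

Lemma quasi_fiber_product_free (R : comNzRingType) n (x : n.-tuple R)
    (M : lmodType R) :
  quasi_fiber_product_ring x -> finitely_generated M ->
  (forall i, (1 <= i <= n + n + 5)%N -> Ext_vanishes i M (M * R^o)%type) ->
  free_module M.
Proof.
move=> qx [c0 [g0 hg0]] E.
have [m [I [J [mm IJ nI nJ]]]] := quasi_fiber_product_splits qx.
have [hR [regx _] _] := qx.
have hm := noetherian_local_at hR mm; have [noe _] := hR.
have gen0 : generates g0 [set: M]%classic.
  move=> v; split=> // _; have [a ->] := hg0 v; exists (\row_i a i).
  by apply: eq_bigr => i _; rewrite mxE.
have [c [g [hg gm]]] := minimal_generators hm gen0.
have [|e he] := @linear_pack R 'rV[R]_c M (fun u => \sum_i u 0 i *: g i).
  move=> a u v; rewrite scaler_sumr -big_split; apply: eq_bigr => i _ /=.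
  by rewrite !mxE scalerDl scalerA.
have esurj y : exists u, e u = y.
  by have [u ->] := (hg y).1 Logic.I; exists u.
have [||b [d [d0 dker dm]]] :=
  @minimal_free_resolution R m c (fun u => e u = 0) noe hm.
- split; first exact: raddf0.
    by move=> u v hu hv; rewrite raddfD /= hu hv addr0.
  by move=> a u hu; rewrite linearZ /= hu scaler0.
- by move=> u; rewrite he; apply: gm.
have G j : (j <= n + n + 4)%N -> Ext_ring_mod d (ideal_span [::]) j.
  by move=> hj; apply: (Ext_vanishes_ring esurj d0 dker); apply: E; lia.
have S j : (j <= n + n + 4)%N -> Ext_syz_mod d (ideal_span [::]) j 0.
  by move=> hj; apply: (Ext_vanishes_self esurj d0 dker); apply: E; lia.
have dd := exact_comp dker.
have ex i : exact_mod d (ideal_span [::]) i by exact: (exact_mod_nil dker).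
have bn : rank_cons c b n.+2 = 0%N.
  have hZ := ideal_span_is_ideal x.
  have xE : ideal_span x = ideal_span (take n x).
    by rewrite take_oversize // size_tuple.
  apply: (fiber_product_vanishing noe hm hZ dd dm IJ nI nJ).
    move=> i ni; rewrite xE; apply: (exact_mod_take dd regx ex _ ni).
    by rewrite size_tuple.
  rewrite xE; apply: (Ext_syz_mod_take dd regx ex) => [||j hj].
  - by rewrite size_tuple.
  - by lia.
  (* Here [n + 4 <= j <= 2n + 4]. Shifting down [n + 3] times reaches [Ext(M, M)], and the highest
     degree used is [2n + 5], the bound assumed. *)
  - have -> : j = (n.+3 + (j - n.+3))%N by lia.
    rewrite -[X in Ext_syz_mod _ _ _ X]addn0.
    apply: (Ext_syz_mod_shifts dd ex) => [i hi|]; first by apply: G; lia.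
    by apply: S; lia.
apply: (free_module_of_rank0 esurj d0).
apply: (rank0_of_Ext_ring hm dm bn) => j hj; apply: G; lia.
Qed.

Theorem theorem3p31 (R : comNzRingType) (n : nat) (x : n.-tuple R)
    (M : lmodType R) :
  quasi_fiber_product_ring x -> finitely_generated M ->
  [/\ forall t : nat, (maxn 5 n.+1 <= t)%N ->
        (forall i, (1 <= i <= t + depth R + n)%N ->
           Ext_vanishes i M (M * R^o)%type) ->
        free_module M,
      (4 < n)%N ->
        (forall i, (1 <= i <= 3 * n + 2)%N ->
           Ext_vanishes i M (M * R^o)%type) ->
        free_module M,
      (n <= 4)%N ->
        (forall i, (1 <= i <= 5 + 2 * n + 1)%N ->
           Ext_vanishes i M (M * R^o)%type) ->
        free_module M
    & (n <= 4)%N ->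
        (forall i, (1 <= i <= 14)%N ->
           Ext_vanishes i M (M * R^o)%type) ->
        free_module M].
Proof.
move=> qx fgM.
(* All four ranges reach at least [2n + 5], the first one because [n <= depth R]. *)
have free l : (n + n + 5 <= l)%N ->
    (forall i, (1 <= i <= l)%N -> Ext_vanishes i M (M * R^o)%type) ->
    free_module M.
  move=> hl E; apply: (quasi_fiber_product_free qx fgM) => i hi; apply: E; lia.
have nd : (n <= depth R)%N.
  have [m [I [J [mm IJ nI nJ]]]] := quasi_fiber_product_splits qx.
  have [hR regx _] := qx.
  rewrite -[n](size_tuple x); apply: (depth_regular_seq hR mm regx IJ nI nJ).
  (* An element of [x] outside [m] would be a unit, making [R/(x)] zero. *)
  move=> a ax; apply: contrapT => am.
  have [_ _ /(_ _ am)[c ca]] := noetherian_local_at hR mm.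
  have hx := ideal_span_is_ideal x; apply: (proper_ideal1 hx regx.2).
  by rewrite -ca; apply: idealMl => //; apply: mem_ideal_span.
split=> [t ht|hn|hn|hn]; apply: free; lia.
Qed.
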